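(* Let $\Theta\subset\mathbb{R}^p$ and $\Lambda\subset\mathbb{R}^q$ be open and let $F:\Theta\times\Lambda\to\mathbb{R}^{K+1}$ be the joint weak feature map $$F(\theta,\lambda)=\bigl(\langle T_\theta,x^{j_0}\varphi_\lambda(x)\rangle,\ldots,\langle T_\theta,x^{j_K}\varphi_\lambda(x)\rangle\bigr).$$ Let $D\subset\mathbb{R}^{K+1}$ be a smooth submanifold of codimension $c$. If at every point $(\theta,\lambda)\in F^{-1}(D)$ the $(K+1)\times(p+q)$ Jacobian $DF(\theta,\lambda)$, composed with the orthogonal projection $\pi_N$ onto the normal space $N_yD=(T_yD)^\perp$ at $y=F(\theta,\lambda)$, has rank $c$ (that is, $\operatorname{rank}(\pi_N\circ DF(\theta,\lambda))=c$), then $F$ is transversal to $D$.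
   Context: Here $\{T_\theta:\theta\in\Theta\}\subset\mathcal{S}'(\mathbb{R})$ is a family of tempered distributions, $\{\varphi_\lambda\}_{\lambda\in\Lambda}\subset\mathcal{S}(\mathbb{R})$ is a family of positive Schwartz functions (kernels), $0\le j_0<\cdots<j_K$ are fixed integers, and the joint map $F$ is of class $C^r$ with $r\ge1$. Transversality of $F$ to $D$ means that for every $(\theta,\lambda)\in F^{-1}(D)$, with $y=F(\theta,\lambda)$, one has $\operatorname{Im}DF(\theta,\lambda)+T_yD=\mathbb{R}^{K+1}$. *)

(* Defs.v *)
From HB Require Import structures.
From mathcomp Require Import all_boot all_order all_algebra.
From mathcomp Require Import all_classical all_reals all_analysis.

Set Implicit Arguments.
Unset Strict Implicit.
Unset Printing Implicit Defensive.

Import Order.TTheory GRing.Theory Num.Theory.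
Import numFieldNormedType.Exports.

Local Open Scope classical_set_scope.
Local Open Scope ring_scope.

Section Schwartz.
Variable R : realType.
Implicit Types f g : R -> R^o.

Definition is_schwartz f : Prop :=
  (forall n (x : R), derivable (derive1n n f) x 1) /\
  (forall k n, exists M : R, forall x : R, `|x ^+ k * derive1n n f x| <= M).

Definition schwartz_pred : {pred R -> R^o} := mem [set f | is_schwartz f].

Lemma derive1n_lin (a : R) f g n :
  (forall n (x : R), derivable (derive1n n f) x 1) ->
  (forall n (x : R), derivable (derive1n n g) x 1) ->
  derive1n n (a *: f + g) = a *: derive1n n f + derive1n n g.
Proof.
move=> df dg; elim: n => [//|n IH]; rewrite derive1nS IH.
apply/funext => x.
rewrite derive1E (deriveD (derivableZ (df n x)) (dg n x)) (deriveZ _ (df n x)).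
by rewrite -!derive1E.
Qed.

Lemma schwartz_submod_closed : submod_closed schwartz_pred.
Proof.
have d0 n : derive1n n (0 : R -> R^o) = 0.
  elim: n => [//|n IH]; rewrite derive1nS IH; apply/funext => x.
  by rewrite derive1E derive_cst.
split.
  apply/mem_set; split=> [n x|k n]; first by rewrite d0; exact: derivable_cst.
  by exists 0 => x; rewrite d0 mulr0 normr0.
move=> a f g /set_mem[df bf] /set_mem[dg bg]; apply/mem_set; split=> [n x|k n].
  rewrite (derive1n_lin a n df dg).
  exact: (derivableD (derivableZ (df n x)) (dg n x)).
have [M hM] := bf k n; have [N hN] := bg k n; exists (`|a| * M + N) => x.
rewrite (derive1n_lin a n df dg) !fctE mulrDr (le_trans (ler_normD _ _))// lerD//.
rewrite (_ : _ * _ = a * (x ^+ k * derive1n n f x)); last first.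
  by rewrite mulrCA.
by rewrite normrM ler_wpM2l.
Qed.

HB.instance Definition _ :=
  GRing.isSubmodClosed.Build R (R -> R^o) schwartz_pred schwartz_submod_closed.

Record schwartz : Type :=
  Schwartz { schwartz_fun :> R -> R^o ; _ : schwartz_fun \in schwartz_pred }.

HB.instance Definition _ := [isSub for schwartz_fun].
HB.instance Definition _ := gen_eqMixin schwartz.
HB.instance Definition _ := gen_choiceMixin schwartz.
HB.instance Definition _ := [SubChoice_isSubLmodule of schwartz by <:].

Implicit Types u v w : schwartz.

Lemma schwartzP u : is_schwartz u.
Proof. by case: u => f fP; exact: (set_mem fP). Qed.

(* [|u - v|_{k,n} <= e] for all [k, n <= N], with [|u|_{k,n}] the usual
   seminorm [sup_x |x^k u^(n)(x)|]. *)
Definition schwartz_ball (u : schwartz) (N : nat) (e : R) : set schwartz :=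
  [set v | forall k n, (k <= N)%N -> (n <= N)%N ->
     forall x : R, `|x ^+ k * derive1n n (u - v : schwartz) x| <= e].

Definition nbhs_schwartz (u : schwartz) : set_system schwartz :=
  [set A | exists N e, 0 < e /\ schwartz_ball u N e `<=` A].

HB.instance Definition _ := hasNbhs.Build schwartz nbhs_schwartz.

Lemma schwartz_ballxx u N e : 0 < e -> schwartz_ball u N e u.
Proof.
move=> e0 k n _ _ x; rewrite subrr.
suff -> : derive1n n (0 : schwartz) x = 0 by rewrite mulr0 normr0 ltW.
suff -> : derive1n n (0 : schwartz) = 0 by [].
elim: n => [//|n IH]; rewrite derive1nS IH; apply/funext => y.
by rewrite derive1E derive_cst.
Qed.

Lemma schwartz_ball_triangle u v w N e1 e2 : schwartz_ball u N e1 v ->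
  schwartz_ball v N e2 w -> schwartz_ball u N (e1 + e2) w.
Proof.
move=> uv vw k n kN nN x.
have -> : derive1n n (u - w : schwartz) =
    derive1n n (u - v : schwartz) + derive1n n (v - w : schwartz).
  rewrite -[derive1n n (u - v : schwartz)]scale1r -derive1n_lin; first last.
  - exact: (schwartzP _).1.
  - exact: (schwartzP _).1.
  rewrite scale1r; congr (derive1n n _); apply/funext => y /=.
  by rewrite fctE addrA subrK.
rewrite fctE mulrDr (le_trans (ler_normD _ _))// lerD//; [exact: uv|exact: vw].
Qed.

Lemma nbhs_schwartz_filter u : ProperFilter (nbhs u).
Proof.
apply: Build_ProperFilter_ex.
  by move=> A [N [e [e0 sA]]]; exists u; apply: sA; exact: schwartz_ballxx.
split.
- by exists 0, 1.
- move=> A B [N [e [e0 sA]]] [M [d [d0 sB]]].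
  exists (maxn N M), (Num.min e d); split; first by rewrite lt_min e0.
  move=> v uv; split; [apply: sA|apply: sB] => k n kN nN x.
  + have := uv k n (leq_trans kN (leq_maxl _ _))
      (leq_trans nN (leq_maxl _ _)) x.
    by rewrite le_min => /andP[].
  + have := uv k n (leq_trans kN (leq_maxr _ _))
      (leq_trans nN (leq_maxr _ _)) x.
    by rewrite le_min => /andP[].
- move=> A B AB [N [e [e0 sA]]]; exists N, e; split=> //.
  exact: subset_trans AB.
Qed.

Lemma nbhs_schwartz_singleton u (A : set schwartz) : nbhs u A -> A u.
Proof. by move=> [N [e [e0 sA]]]; apply: sA; exact: schwartz_ballxx. Qed.

Lemma nbhs_schwartz_nbhs u (A : set schwartz) :
  nbhs u A -> nbhs u (nbhs^~ A).
Proof.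
move=> [N [e [e0 sA]]]; exists N, (e / 2); split; first by rewrite divr_gt0.
move=> v uv; exists N, (e / 2); split; first by rewrite divr_gt0.
move=> w vw; apply: sA; rewrite [e]splitr.
exact: schwartz_ball_triangle vw.
Qed.

HB.instance Definition _ := Nbhs_isNbhsTopological.Build schwartz
  nbhs_schwartz_filter nbhs_schwartz_singleton nbhs_schwartz_nbhs.

Lemma is_schwartz_mulx f : is_schwartz f -> is_schwartz (fun x : R => x * f x).
Proof.
move=> [df bf].
have ME n m : (fun x : R => derive1n m f x *+ n : R^o) = n%:R *: derive1n m f.
  by apply/funext => y; rewrite fctE -scaler_nat.
have h1 n (x : R) : derivable (fun x : R => x * derive1n n f x : R^o) x 1.
  by apply: derivableM => //; exact: derivable_id.
have h2 n m (x : R) : derivable (fun x : R => derive1n m f x *+ n : R^o) x 1.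
  by rewrite ME; exact: derivableZ.
have dE n : derive1n n (fun x : R => x * f x : R^o) =
    (fun x : R => x * derive1n n f x + derive1n n.-1 f x *+ n).
  elim: n => [|n IH]; first by apply/funext => x; rewrite mulr0n addr0.
  rewrite derive1nS IH; apply/funext => x.
  rewrite derive1E (deriveD (h1 n x) (h2 n n.-1 x)).
  have -> : 'D_1 (fun x : R => x * derive1n n f x : R^o) x =
      x * derive1n n.+1 f x + derive1n n f x.
    apply: etrans (deriveM (@derivable_id _ _ x 1) (df n x)) _.
    by rewrite derive_id -derive1E; congr (_ + _); exact: mulr1.
  rewrite ME (deriveZ _ (df n.-1 x)) -derive1E scaler_nat -addrA; congr (_ + _).
  by case: n {IH} => [|n]; rewrite /= ?mulr0n ?addr0 // mulrS.
split=> [n x|k n]; first by rewrite dE; exact: derivableD (h1 n x) (h2 n n.-1 x).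
have [M hM] := bf k.+1 n; have [N hN] := bf k n.-1.
exists (M + N *+ n) => x; rewrite dE mulrDr mulrA -exprSr.
by rewrite (le_trans (ler_normD _ _))// lerD// mulrnAr normrMn lerMn2r hN orbT.
Qed.

Lemma is_schwartz_monomial (k : nat) u :
  (fun x : R => x ^+ k * u x) \in schwartz_pred.
Proof.
apply/mem_set; elim: k => [|k IH].
  have -> : (fun x : R => x ^+ 0 * u x) = u.
    by apply/funext => x; rewrite expr0 mul1r.
  exact: schwartzP.
have -> : (fun x : R => x ^+ k.+1 * u x) = (fun x => x * (x ^+ k * u x)).
  by apply/funext => x; rewrite exprS mulrA.
exact: is_schwartz_mulx.
Qed.

Definition monomial_mul (k : nat) (u : schwartz) : schwartz :=
  Schwartz (is_schwartz_monomial k u).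

Record tempered_distribution : Type := TemperedDistribution {
  pairing :> {linear schwartz -> R^o} ;
  _ : continuous pairing }.

End Schwartz.

Section Differential.
Variable R : realType.

(* Meant for open [U] and finite-dimensional [V], [W]. *)
Fixpoint class_C (V W : normedModType R) (r : nat) (U : set V) (f : V -> W) :
    Prop :=
  match r with
  | 0 => {in U, continuous f}
  | r'.+1 => (forall x, U x -> differentiable f x) /\
             (forall v, class_C r' U (fun x => 'D_v f x))
  end.

Definition smooth_on (V W : normedModType R) (U : set V) (f : V -> W) : Prop :=
  forall r, class_C r U f.

Section Submanifold.
Variable n : nat.

(* Slice charts: around each of its points, [D] is carried by a smooth
   diffeomorphism [psi : U -> V] onto the part of [V] where the first [c]
   coordinates vanish. *)
Definition smooth_submanifold (c : nat) (D : set 'rV[R]_n) : Prop :=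
  (c <= n)%N /\
  forall y, D y -> exists (U V : set 'rV[R]_n) (psi chi : 'rV[R]_n -> 'rV[R]_n),
    [/\ [/\ open U, open V & U y],
        [/\ smooth_on U psi, smooth_on V chi,
            forall x, U x -> V (psi x) /\ chi (psi x) = x &
            forall z, V z -> U (chi z) /\ psi (chi z) = z] &
        forall x, U x -> (D x <-> forall i : 'I_n, (i < c)%N -> psi x 0 i = 0)].

(* Velocities at [y] of the smooth curves drawn on [D]. *)
Definition tangent_subspace (D : set 'rV[R]_n) (y : 'rV[R]_n) : set 'rV[R]_n :=
  [set v | exists (e : R) (gamma : R^o -> 'rV[R]_n),
     [/\ 0 < e, smooth_on (ball (0 : R^o) e) gamma,
         forall t, ball (0 : R^o) e t -> D (gamma t),
         gamma 0 = y & derive1 gamma 0 = v]].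

Definition dotrv (v w : 'rV[R]_n) : R := \sum_i v 0 i * w 0 i.

Definition orthogonal_space (S : set 'rV[R]_n) : set 'rV[R]_n :=
  [set v | forall w, S w -> dotrv v w = 0].

Definition normal_subspace (D : set 'rV[R]_n) (y : 'rV[R]_n) : set 'rV[R]_n :=
  orthogonal_space (tangent_subspace D y).

Definition is_orth_proj (S : set 'rV[R]_n) (P : 'M[R]_n) : Prop :=
  forall v, S (v *m P) /\ orthogonal_space S (v - v *m P).

(* The orthogonal projection onto [S], as a matrix acting on row vectors from
   the right; a junk value if there is none ([S] not a linear subspace). *)
Definition orth_proj (S : set 'rV[R]_n) : 'M[R]_n := xget 0 (is_orth_proj S).

Lemma dotrvE (v w : 'rV[R]_n) : dotrv v w = (v *m w^T) 0 0.
Proof. by rewrite mxE; apply: eq_bigr => i _; rewrite mxE. Qed.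

Lemma dotrvBl (u v w : 'rV[R]_n) : dotrv (u - v) w = dotrv u w - dotrv v w.
Proof. by rewrite -sumrB; apply: eq_bigr => i _; rewrite !mxE mulrBl. Qed.

Lemma dotrv_eq0 (v : 'rV[R]_n) : dotrv v v = 0 -> v = 0.
Proof.
move=> /eqP; rewrite psumr_eq0; last by move=> i _; rewrite -expr2 sqr_ge0.
move=> /allP vv; apply/rowP => i; rewrite mxE; apply/eqP.
by have := vv i; rewrite mem_index_enum -expr2 sqrf_eq0 => /(_ isT).
Qed.

Lemma is_orth_proj_uniq m (A : 'M[R]_(m, n)) (P Q : 'M[R]_n) :
  is_orth_proj [set v : 'rV_n | (v <= A)%MS] P ->
  is_orth_proj [set v : 'rV_n | (v <= A)%MS] Q -> P = Q.
Proof.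
move=> hP hQ; apply/row_matrixP => i; rewrite !rowE; set v := delta_mx _ _.
have [pA pO] := hP v; have [qA qO] := hQ v; apply/eqP; rewrite -subr_eq0.
have dA : (v *m P - v *m Q <= A)%MS by rewrite addmx_sub// eqmx_opp.
apply/eqP/dotrv_eq0; rewrite {1}(_ : v *m P - v *m Q =
  (v - v *m Q) - (v - v *m P)); last first.
  by rewrite opprB [RHS]addrC addrA subrK.
by rewrite dotrvBl pO// qO// subrr.
Qed.

Lemma orth_projP m (A : 'M[R]_(m, n)) :
  is_orth_proj [set v : 'rV_n | (v <= A)%MS]
    (orth_proj [set v : 'rV_n | (v <= A)%MS]).
Proof.
rewrite /orth_proj; case: xgetP => // /(_ (proj_mx <<A>>%MS (kermx A^T))) [].
have Kdot (v w : 'rV[R]_n) : (v <= kermx A^T)%MS -> (w <= A)%MS ->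
    dotrv v w = 0.
  move=> /sub_kermxP vK /submxP[B ->].
  by rewrite dotrvE trmx_mul mulmxA vK mul0mx mxE.
have dx : (<<A>> :&: kermx A^T = 0)%MS.
  apply/eqP; rewrite -submx0; apply/rV_subP => w; rewrite sub_capmx genmxE.
  by move=> /andP[wA wK]; rewrite (dotrv_eq0 (Kdot _ _ wK wA)) sub0mx.
have full : row_full (<<A>> + kermx A^T)%MS.
  rewrite -col_leq_rank mxrank_disjoint_sum// genmxE mxrank_ker mxrank_tr.
  by rewrite subnKC// rank_leq_col.
move=> v; split; first by rewrite /= -(genmxE A) proj_mx_sub.
move=> w wA; apply: Kdot => //.
have vs : (v <= <<A>> + kermx A^T)%MS by rewrite submx_full.
by rewrite -{1}(add_proj_mx dx vs) addrC addrA addNr add0r proj_mx_sub.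
Qed.

End Submanifold.

Definition transversal_to (m n : nat) (U : set 'rV[R]_m)
    (f : 'rV[R]_m -> 'rV[R]_n) (D : set 'rV[R]_n) : Prop :=
  forall z, U z -> D (f z) ->
    [set 'd f z u + t | u in setT & t in tangent_subspace D (f z)] = setT.

End Differential.

Section FeatureMap.
Variables (R : realType) (p q K : nat).

(* [R^p * R^q] is identified with [R^(p+q)]: the joint parameter
   [(theta, lambda)] is [row_mx theta lambda]. *)
Definition joint_domain (Theta : set 'rV[R]_p) (Lambda : set 'rV[R]_q) :
    set 'rV[R]_(p + q) :=
  [set z | Theta (lsubmx z) /\ Lambda (rsubmx z)].

Definition weak_feature_map (T : 'rV[R]_p -> tempered_distribution R)
    (phi : 'rV[R]_q -> schwartz R) (j : 'I_K.+1 -> nat)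
    (z : 'rV[R]_(p + q)) : 'rV[R]_K.+1 :=
  \row_k pairing (T (lsubmx z)) (monomial_mul (j k) (phi (rsubmx z))).

End FeatureMap.

(* Main.v *)
Require Import Defs.
From HB Require Import structures.
From mathcomp Require Import all_boot all_order all_algebra.
From mathcomp Require Import all_classical all_reals all_analysis.
Import Order.TTheory GRing.Theory Num.Theory.
Import numFieldNormedType.Exports.
Local Open Scope classical_set_scope.
Local Open Scope ring_scope.

(** Transversality at a point is a statement of linear algebra once the tangent
    space [T] of [D] at [y] is known to be a linear subspace of codimension at
    most [c].  A slice chart [psi] provides this: [T] is the common kernel of
    the differentials at [y] of the [c] coordinates of [psi] that cut out [D]
    ([tangent_subspace_kernel]).  A velocity of a curve on [D] is killed by these
    differentials because the coordinates vanish along the curve; conversely, a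
    vector killed by them is the velocity of the curve that the inverse chart
    makes out of a straight segment of the slice.

    Write [T] as the row vectors [v] with [v *m A = 0], where [A] has [c]
    columns.  The normal space is then the row space of [A^T], of dimension at
    most [c], so a composite [J *m P] of rank [c] with the projection [P] fills
    it.  Hence for every [v] there is [u] with [v *m P = u *m J *m P].  The
    projection kills [v - u *m J], which is therefore orthogonal to the normal
    space, that is, killed by [A], that is, tangent
    ([orth_proj_full_rank_splitting]). *)

(** * The tangent space of a submanifold is a kernel *)

(** The derivative along the line is the restriction to the line of a
    directional derivative of [f]; this makes the induction on the order go
    through without any chain rule for higher derivatives. *)
Lemma smooth_on_line {R : realType} {V W : normedModType R} {U : set V}
    {f : V -> W} {a w : V} {B : set R^o} :
  smooth_on U f -> (forall t, B t -> U (a + t *: w)) ->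
  smooth_on B (fun t : R^o => f (a + t *: w)).
Proof.
move=> sf BU r; have {sf} := sf r.
have dl (t : R^o) : differentiable (fun t : R^o => a + t *: w) t.
  by apply: differentiableD => //; exact: differentiableZl.
elim: r f => [|r IH] f /=.
  move=> cf t /set_mem/BU/mem_set/cf cft.
  apply: (@continuous_comp _ _ _ (fun t : R^o => a + t *: w) f) cft.
  exact: differentiable_continuous.
move=> [df Cf]; split=> [t /BU/df dft|s].
  exact: (@differentiable_comp _ _ _ _ (fun t : R^o => a + t *: w) f).
have -> : (fun t : R^o => 'D_s (fun t : R^o => f (a + t *: w)) t) =
    (fun t : R^o => 'D_((s : R) *: w) f (a + t *: w)).
  apply/funext => t; rewrite /derive; apply: (congr1 (fun q => lim (q @ 0^'))).
  apply/funext => h /=; congr (_ *: (f _ - _)).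
  by rewrite scalerDl scalerA addrCA.
exact: (IH _ (Cf ((s : R) *: w))).
Qed.

Lemma derive1_line {R : realType} {V W : normedModType R} {f : V -> W} {a w : V} :
  derive1 (fun t : R^o => f (a + t *: w)) 0 = 'D_w f a.
Proof.
rewrite /derive1 /derive; apply: (congr1 (fun q => lim (q @ 0^'))).
apply/funext => h /=.
by rewrite addr0 scale0r addr0 [a + _]addrC.
Qed.

Lemma line_in_open {R : realType} {V : normedModType R} {U : set V} {a : V} (w : V) :
  open U -> U a ->
  exists2 e : R, 0 < e & forall t, ball (0 : R^o) e t -> U (a + t *: w).
Proof.
move=> oU Ua.
have cl : {for (0 : R^o), continuous (fun t : R^o => a + t *: w)}.
  apply: differentiable_continuous.
  by apply: differentiableD => //; exact: differentiableZl.
have : nbhs (0 : R^o) [set t : R^o | U (a + t *: w)].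
  apply: cl; rewrite /= scale0r addr0; exact: open_nbhs_nbhs.
by move=> /nbhs_ballP[e /= e0 eU]; exists e.
Qed.

Lemma derive_comp {R : realType} {V1 V2 V3 : normedModType R}
    {f : V1 -> V2} {g : V2 -> V3} {a v : V1} :
  differentiable f a -> differentiable g (f a) ->
  'D_v (g \o f) a = 'd g (f a) ('D_v f a).
Proof.
move=> df dg.
by rewrite (deriveE _ df) (deriveE _ (differentiable_comp df dg)) diff_comp.
Qed.

Lemma derive_coord {R : realType} {V : normedModType R} {n : nat}
    {f : V -> 'rV[R]_n} {a v : V} (i : 'I_n) :
  differentiable f a -> 'D_v (fun x => f x 0 i : R^o) a = 'D_v f a 0 i.
Proof.
move=> df.
pose c := fun N : 'rV[R]_n => N 0 i : R^o.
have clin : linear c by move=> k M N; rewrite /c !mxE.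
pose cL : {linear 'rV[R]_n -> R^o} := HB.pack c
  (GRing.isLinear.Build _ _ _ _ c clin).
rewrite (@derive_comp _ _ _ _ f c) //; last exact: differentiable_coord.
by rewrite (@diff_lin _ _ _ cL) //; exact: coord_continuous.
Qed.

(** The first [c] columns of the Jacobian of a slice chart serve.  Having only
    [c] columns is what later bounds the dimension of the normal space. *)
Lemma tangent_subspace_kernel {R : realType} {n c : nat} {D : set 'rV[R]_n}
    {y : 'rV[R]_n} :
  smooth_submanifold c D -> D y ->
  exists A : 'M[R]_(n, c), tangent_subspace D y = [set v | v *m A = 0].
Proof.
move=> [cn charts] Dy.
have [U [V [psi [chi [[oU oV Uy] [spsi schi psiK chiK] slice]]]]] := charts y Dy.
have dpsi : differentiable psi y by exact: (spsi 1%N).1.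
have dchi : differentiable chi (psi y) by exact: (schi 1%N).1 _ (psiK y Uy).1.
pose A : 'M[R]_(n, c) := \matrix_(i, k) jacobian psi y i (widen_ord cn k).
have AE v k : (v *m A) 0 k = 'D_v psi y 0 (widen_ord cn k).
  by rewrite deriveEjacobian // !mxE; apply: eq_bigr => l _; rewrite mxE.
have kerE v :
    v *m A = 0 <-> forall i : 'I_n, (i < c)%N -> 'D_v psi y 0 i = 0.
  split=> [vA i ic|vker]; last by apply/rowP => k; rewrite [RHS]mxE AE vker /=.
  have -> : i = widen_ord cn (Ordinal ic) by exact: val_inj.
  by rewrite -AE vA mxE.
exists A.
apply/seteqP; split=> v /=; rewrite kerE.
  move=> [e [gamma [e0 sgamma Dgamma gamma0 <-]]] i ic.
  have dgamma : differentiable gamma 0.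
    by apply: (sgamma 1%N).1; exact: ballxx.
  have near0 : \forall t \near (0 : R^o), psi (gamma t) 0 i = 0.
    have nU : nbhs (0 : R^o) (gamma @^-1` U).
      apply: (differentiable_continuous dgamma); rewrite gamma0.
      exact: open_nbhs_nbhs.
    apply: filterS2 nU (nbhsx_ballx (0 : R^o) e e0) => t Ut /Dgamma Dt.
    exact: (slice _ Ut).1.
  rewrite -gamma0 in dpsi *.
  rewrite derive1E (deriveE _ dpsi) -(derive_comp dgamma dpsi).
  rewrite -(derive_coord i); last exact: differentiable_comp.
  by rewrite (near_eq_derive _ near0) derive_cst.
move=> vker; set w := 'D_v psi y.
have [e e0 eV] := line_in_open w oV (psiK y Uy).1.
exists e, (fun t : R^o => chi (psi y + t *: w)); split => //.
- exact: smooth_on_line schi eV.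
- move=> t /eV Vt; have [Ut psit] := chiK _ Vt.
  apply/(slice _ Ut) => i ic; rewrite psit !mxE vker // mulr0 addr0.
  exact: (slice y Uy).1.
- by rewrite scale0r addr0 (psiK y Uy).2.
- rewrite derive1_line (deriveE _ dchi) -(derive_comp dpsi dchi).
  have nU : nbhs y U by exact: open_nbhs_nbhs.
  have idE : \forall x \near y, (chi \o psi) x = id x.
    by apply: filterS nU => x /psiK[].
  by rewrite (near_eq_derive _ idE) derive_id.
Qed.

(** * Splitting by the normal projection *)

Lemma dotrvC {R : realType} {n : nat} (v w : 'rV[R]_n) : dotrv v w = dotrv w v.
Proof. by apply: eq_bigr => i _; rewrite mulrC. Qed.

Lemma orthogonal_row_space {R : realType} {m n : nat} (A : 'M[R]_(m, n)) :
  orthogonal_space [set w : 'rV_n | (w <= A)%MS] =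
  [set v : 'rV_n | v *m A^T = 0].
Proof.
apply/seteqP; split=> v /= vA.
  apply/rowP => i; rewrite [RHS]mxE -[RHS](vA (row i A) (row_sub i A)) mxE.
  by apply: eq_bigr => k _; rewrite !mxE.
by move=> w /submxP[B ->]; rewrite dotrvE trmx_mul mulmxA vA mul0mx mxE.
Qed.

(** This is the equality of a row space with its double orthogonal: a vector
    orthogonal to the kernel of [A] differs from its projection onto the row
    space of [A^T] by a vector orthogonal to itself. *)
Lemma orthogonal_kernel {R : realType} {m n : nat} (A : 'M[R]_(n, m)) :
  orthogonal_space [set w : 'rV_n | w *m A = 0] =
  [set v : 'rV_n | (v <= A^T)%MS].
Proof.
have kerA : [set w : 'rV_n | w *m A = 0] =
    orthogonal_space [set w : 'rV_n | (w <= A^T)%MS].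
  by rewrite orthogonal_row_space trmxK.
rewrite kerA; apply/seteqP; split=> v /= vA; last first.
  by move=> w wA; rewrite dotrvC; exact: wA.
have [vP vOP] := orth_projP A^T v.
set P := orth_proj _ in vP vOP.
have d0 : dotrv (v - v *m P) (v - v *m P) = 0.
  rewrite {1}dotrvBl [dotrv (v *m P) _]dotrvC (vOP _ vP) subr0.
  exact: vA vOP.
by rewrite -[v](subrK (v *m P)) (dotrv_eq0 d0) add0r.
Qed.

(** The row space of [A^T] has dimension at most [c], so the rank hypothesis
    forces [J *m P] to fill it. *)
Lemma orth_proj_full_rank_splitting {R : realType} {m n c : nat}
    {A : 'M[R]_(n, c)} {J : 'M[R]_(m, n)} :
  \rank (J *m orth_proj [set v : 'rV_n | (v <= A^T)%MS]) = c ->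
  forall v : 'rV[R]_n, exists u : 'rV[R]_m, (v - u *m J) *m A = 0.
Proof.
have := orth_projP A^T; set P := orth_proj _ => projP rJP v.
have JPA : (J *m P <= A^T)%MS.
  by apply/row_subP => i; rewrite row_mul; exact: (projP _).1.
have AJP : (A^T <= J *m P)%MS.
  by rewrite -(geq_leqif (mxrank_leqif_sup JPA)) rJP rank_leq_row.
have /submxP[u vP] := submx_trans (projP v).1 AJP.
exists u; have := (projP (v - u *m J)).2.
rewrite mulmxBl vP -mulmxA subrr subr0.
by rewrite -[orthogonal_space _ _]/(_ _) orthogonal_row_space /= trmxK.
Qed.

(** * Transversality *)

Lemma transversal_of_normal_rank {R : realType} {m n c : nat}
    {U : set 'rV[R]_m} {f : 'rV[R]_m -> 'rV[R]_n} {D : set 'rV[R]_n} :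
  smooth_submanifold c D ->
  (forall z, U z -> D (f z) ->
     \rank (jacobian f z *m orth_proj (normal_subspace D (f z))) = c) ->
  transversal_to U f D.
Proof.
move=> smD rk z Uz Dfz; have {rk} := rk z Uz Dfz.
have [A TA] := tangent_subspace_kernel smD Dfz.
rewrite /normal_subspace TA orthogonal_kernel => rJP.
apply/seteqP; split=> // v _.
have [u vuJ] := orth_proj_full_rank_splitting rJP v.
exists u => //; exists (v - u *m jacobian f z) => //.
by rewrite /jacobian mul_rV_lin1 addrC subrK.
Qed.

(* Points of R^n are row vectors, so [jacobian F z] is the transpose of the
   (K+1) x (p+q) Jacobian matrix and [jacobian F z *m P] is the (transposed)
   matrix of the composite P o DF. *)
Theorem corollary5p5 (R : realType) (p q K r c : nat)
  (Theta : set 'rV[R]_p) (Lambda : set 'rV[R]_q)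
  (T : 'rV[R]_p -> tempered_distribution R)
  (phi : 'rV[R]_q -> schwartz R)
  (j : 'I_K.+1 -> nat)
  (D : set 'rV[R]_K.+1)
  (F := weak_feature_map T phi j : 'rV[R]_(p + q) -> 'rV[R]_K.+1)
  (openTheta : open Theta) (openLambda : open Lambda)
  (phi_pos : forall lambda, Lambda lambda -> forall x, 0 < phi lambda x)
  (j_incr : forall k l : 'I_K.+1, (k < l)%N -> (j k < j l)%N)
  (r_ge1 : (1 <= r)%N)
  (F_Cr : class_C r (joint_domain Theta Lambda) F)
  (D_submanifold : smooth_submanifold c D)
  (rank_condition : forall theta lambda, Theta theta -> Lambda lambda ->
     let z := row_mx theta lambda in
     D (F z) ->
     \rank (jacobian F z *m orth_proj (normal_subspace D (F z))) = c) :
  transversal_to (joint_domain Theta Lambda) F D.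
Proof.
apply: transversal_of_normal_rank D_submanifold _ => z [Thz Laz].
by rewrite -[z]hsubmxK; exact: rank_condition.
Qed.
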